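(* Let $X$ and $T$ be diffeological spaces and let $\varrho:G\to\mathrm{Diff}(T)$ be a smooth faithful action of a (not necessarily abelian) diffeological group $G$ on $T$. There is a bijective correspondence $$\Theta:\check H^1(X,G)\to\mathrm{Bund}_T(X,G)$$ between the first (non-abelian) diffeological Čech cohomology classes $\check H^1(X,G)$ with coefficients in the sheaf of smooth functions in $G$ on $X$ and the set $\mathrm{Bund}_T(X,G)$ of isomorphism classes of diffeological fiber bundles with gauge group $G$ and typical fiber $T$ on $X$.
   Context: Diffeology. A domain is an open subset of some $\mathbb{R}^n$; a diffeology on a set $X$ is a set of parametrizations (maps from domains to $X$), called plots, whose images cover $X$, closed under precomposition with smooth maps between domains and under suprema of compatible families (families of plots on $n$-domains agreeing on overlaps). Smooth maps are those sending plots to plots by composition. A covering generating family of $X$ is a set $\mathcal{C}$ of plots whose images cover $X$ and such that every plot is the supremum of a compatible family of parametrizations $P\circ F$ with $P\in\mathcal{C}$, $F$ smooth between domains. A morphism of plots $Q\xrightarrow{F}P$ is a smooth map $F:\mathrm{dom}(Q)\to\mathrm{dom}(P)$ with $P\circ F=Q$. A diffeological group is a group with a diffeology making multiplication and inversion smooth. $\mathrm{Diff}(T)$ is the group of diffeomorphisms of $T$ with the standard diffeology: $P:U\to\mathrm{Diff}(T)$ is a plot iff $(r,t)\mapsto P(r)(t)$ and $(r,t)\mapsto P(r)^{-1}(t)$ are smooth on $U\times T$. A smooth action is a smooth homomorphism $G\to\mathrm{Diff}(T)$; faithful means injective. We write $\varrho g(r)(t)$ for $\varrho(g(r))(t)$.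 Simplices. A $1$-simplex on $\mathcal{C}$ is a diagram $P_0\xleftarrow{F_1}Q\xrightarrow{F_0}P_1$ of morphisms of plots with $P_0,P_1\in\mathcal{C}$. A $2$-simplex on $\mathcal{C}$ consists of $P_0,P_1,P_2\in\mathcal{C}$, $1$-simplices $P_0\xleftarrow{F_{2,1}}Q_2\xrightarrow{F_{2,0}}P_1$, $P_0\xleftarrow{F_{1,2}}Q_1\xrightarrow{F_{1,0}}P_2$, $P_1\xleftarrow{F_{0,2}}Q_0\xrightarrow{F_{0,1}}P_2$, a plot $Q$ and morphisms $Q\xrightarrow{F_i}Q_i$ ($i=0,1,2$) with $F_{i,j}\circ F_i=F_{j,i}\circ F_j$. Bundles. A diffeological fiber bundle with gauge group $G$ and typical fiber $T$ on $X$ is a smooth map $\pi:E\to X$ together with a covering generating family $\mathcal{C}$ of $X$ and: (a) for every $P\in\mathcal{C}$ a smooth map $\psi_P:\mathrm{dom}(P)\times T\to E$ (trivialization) such that the square $\pi\circ\psi_P=P\circ\mathrm{Pr}_1$ is a pullback in the category of diffeological spaces; (b) for each $1$-simplex a smooth map $g_{P_0\xleftarrow{F_1}Q\xrightarrow{F_0}P_1}:\mathrm{dom}(Q)\to G$ (transition) with $\psi_{P_1}(F_0(r),t)=\psi_{P_0}\big(F_1(r),\varrho g_{P_0\xleftarrow{F_1}Q\xrightarrow{F_0}P_1}(r)(t)\big)$ for all $(r,t)\in\mathrm{dom}(Q)\times T$. A refinement of $\mathcal{C}=\{P_\alpha\}_{\alpha\in I}$ is a covering generating family $\mathcal{C}'=\{P'_\beta\}_{\beta\in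 J}$ with a map $\lambda:J\to I$ and morphisms $P'_\beta\xrightarrow{f_\beta}P_{\lambda(\beta)}$. An isomorphism between two such bundles $\pi:E\to X$, $\pi':E'\to X$ (with data $\mathcal{C},\psi,g$ and $\mathcal{C}',\psi',g'$) is a diffeomorphism $\Phi:E\to E'$ with $\pi'\circ\Phi=\pi$, together with a common refinement $\mathcal{B}=\{R_\beta\}_{\beta\in J}$ of $\mathcal{C}$ and $\mathcal{C}'$ with refinement data $P_{\lambda(\beta)}\xleftarrow{f_\beta}R_\beta\xrightarrow{f'_\beta}P'_{\lambda'(\beta)}$, such that for each $\beta$ there is a smooth map $h_\beta:\mathrm{dom}(R_\beta)\to G$ with $\Phi\circ\psi_{P_{\lambda(\beta)}}(f_\beta(r),t)=\psi'_{P'_{\lambda'(\beta)}}(f'_\beta(r),\varrho h_\beta(r)(t))$ for all $(r,t)$. Being isomorphic is an equivalence relation; $\mathrm{Bund}_T(X,G)$ is the set of its classes. Čech cohomology. A diffeological Čech $1$-cocycle on $\mathcal{C}$ with values in $G$ assigns to each $1$-simplex on $\mathcal{C}$ a smooth map $g_{P_0\xleftarrow{F_1}Q\xrightarrow{F_0}P_1}:\mathrm{dom}(Q)\to G$ such that for every $2$-simplex on $\mathcal{C}$ and $r\in\mathrm{dom}(Q)$, $g_{P_0\xleftarrow{F_{2,1}}Q_2\xrightarrow{F_{2,0}}P_1}(F_2(r))\,g_{P_1\xleftarrow{F_{0,2}}Q_0\xrightarrow{F_{0,1}}P_2}(F_0(r))=g_{P_0\xleftarrow{F_{1,2}}Q_1\xrightarrow{F_{1,0}}P_2}(F_1(r))$.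 Cocycles $g,g'$ on $\mathcal{C}$ are equivalent if there are smooth maps $h_P:\mathrm{dom}(P)\to G$ ($P\in\mathcal{C}$) with $g'_{P_0\xleftarrow{F_1}Q\xrightarrow{F_0}P_1}(r)\,h_{P_1}(F_0(r))=h_{P_0}(F_1(r))\,g_{P_0\xleftarrow{F_1}Q\xrightarrow{F_0}P_1}(r)$ for every $1$-simplex on $\mathcal{C}$ and all $r\in\mathrm{dom}(Q)$. $H^1(X,\mathcal{C},G)$ is the set of equivalence classes. A refinement induces a map $j(\mathcal{C}',\mathcal{C}):H^1(X,\mathcal{C},G)\to H^1(X,\mathcal{C}',G)$ by assigning to a $1$-simplex $P'_{\beta_0}\xleftarrow{F_1}Q\xrightarrow{F_0}P'_{\beta_1}$ the value of $g$ at $P_{\lambda(\beta_0)}\xleftarrow{f_{\beta_0}F_1}Q\xrightarrow{f_{\beta_1}F_0}P_{\lambda(\beta_1)}$; it does not depend on the particular refinement map. $\check H^1(X,G)=\varinjlim_{\mathcal{C}}H^1(X,\mathcal{C},G)$. *)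

(* Defs.v *)
From HB Require Import structures.
From mathcomp Require Import all_boot all_order all_algebra.
From mathcomp Require Import boolp classical_sets functions.
From mathcomp Require Import reals topology normedtype landau derive.
Set Implicit Arguments.
Unset Strict Implicit.
Unset Printing Implicit Defensive.
Import Order.TTheory GRing.Theory Num.Theory.
Import numFieldNormedType.Exports.
Local Open Scope classical_set_scope.
Local Open Scope ring_scope.

(* f is of class C^k on U: continuous for k = 0, and for k + 1 differentiable with
   every directional derivative of class C^k. To be used with U open. *)
Fixpoint Ck (R : realType) (V W : normedModType R) (k : nat) (U : set V)
    (f : V -> W) : Prop :=
  if k is k'.+1 then
    (forall x, U x -> differentiable f x) /\
    (forall v, Ck k' U (fun x => 'D_v f x))
  else forall x, U x -> {for x, continuous f}.

Section CkTheory.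
Context {R : realType}.
Implicit Types (V W : normedModType R) (k n m p : nat).

Lemma near_eq_differentiable V W (f g : V -> W) (x : V) :
  (\near x, f x = g x) -> differentiable f x -> differentiable g x.
Proof.
move=> fg df.
have gx : f x = g x by exact: (nbhs_singleton fg).
have h0 : \forall h \near (0 : V), f (h + x) = g (h + x).
  have c : (h + x)@[h --> (0:V)] --> x.
    rewrite -{2}[x]add0r.
    by apply: cvgD; [exact: cvg_id|exact: cvg_cst].
  exact: c fg.
have [dc fE] := (diff_locallyP _ _).1 df.
have E : g \o shift x = cst (g x) + 'd f x +o_ (0:V) id.
  apply/eqaddoP => e e0.
  move/eqaddoP : fE => /(_ _ e0) fE.
  near=> y.
  have h0y : f (y + x) = g (y + x) by near: y; exact: h0.
  have fEy : `|(f \o shift x - (cst (f x) + 'd f x)) y| <= e * `|y|.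
    by near: y; exact: fE.
  by move: fEy; rewrite gx !fctE /= h0y.
by apply/diff_locallyP; rewrite (diff_unique dc E).
Unshelve. all: by end_near. Qed.

Lemma Ck_eq V W k (U : set V) (f g : V -> W) : open U ->
  (forall x, U x -> f x = g x) -> Ck k U f -> Ck k U g.
Proof.
move=> oU; elim: k f g => [|k IH] f g fg /=.
  move=> H x Ux; have nfg : \near x, f x = g x.
    by move/open_nbhs_nbhs: (conj oU Ux); apply: filterS => y; exact: fg.
  rewrite /prop_for /continuous_at -(fg _ Ux).
  apply: cvg_trans (H x Ux); apply: near_eq_cvg.
  by apply: filterS nfg => y ->.
move=> [df Df]; split=> [x Ux|v].
  apply: near_eq_differentiable (df x Ux).
  by move/open_nbhs_nbhs: (conj oU Ux); apply: filterS => y; exact: fg.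
apply: IH (Df v) => x Ux; apply: near_eq_derive.
by move/open_nbhs_nbhs: (conj oU Ux); apply: filterS => y; exact: fg.
Qed.

Lemma Ck_sub V W k (U U' : set V) (f : V -> W) : U' `<=` U ->
  Ck k U f -> Ck k U' f.
Proof.
move=> UU; elim: k f => [|k IH] f /=; first by move=> H x /UU; exact: H.
by move=> [df Df]; split=> [x /UU|v]; [exact: df|exact: IH].
Qed.

Lemma Ck_local V W k (U : set V) (f : V -> W) :
  (forall x, U x -> exists2 U', U' x & Ck k U' f) -> Ck k U f.
Proof.
elim: k f => [|k IH] f H /=; first by move=> x /H[U' U'x Hf]; exact: Hf.
split=> [x /H[U' U'x [df _]]|v]; first exact: df.
by apply: IH => x /H[U' U'x [_ D]]; exists U' => //; exact: D.
Qed.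

Lemma Ck_pred V W k (U : set V) (f : V -> W) : Ck k.+1 U f -> Ck k U f.
Proof.
elim: k f => [|k IH] f [df Df].
  by move=> x Ux; exact: differentiable_continuous (df x Ux).
by split=> // v; exact: IH (Df v).
Qed.

Lemma Ck_cst V W k (U : set V) (a : W) : Ck k U (fun _ : V => a).
Proof.
elim: k a => [|k IH] a /=; first by move=> x Ux; exact: cvg_cst.
split=> [x Ux|v]; first exact: differentiable_cst.
have -> : (fun x : V => 'D_v (fun _ : V => a) x) = fun _ => 0.
  by apply/funext => x; exact: derive_cst.
exact: IH.
Qed.

Lemma Ck_add V W k (U : set V) (f g : V -> W) : open U ->
  Ck k U f -> Ck k U g -> Ck k U (fun x => f x + g x).
Proof.
move=> oU; elim: k f g => [|k IH] f g /=.
  by move=> Hf Hg x Ux; apply: cvgD; [exact: Hf|exact: Hg].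
move=> [df Df] [dg Dg]; split=> [x Ux|v].
  by apply: differentiableD; [exact: df|exact: dg].
apply: (Ck_eq oU _ (IH _ _ (Df v) (Dg v))) => x Ux.
by rewrite deriveD//; apply: diff_derivable; [exact: df|exact: dg].
Qed.

Lemma Ck_sum V W k n (U : set V) (f : 'I_n -> V -> W) : open U ->
  (forall i, Ck k U (f i)) -> Ck k U (fun x => \sum_(i < n) f i x).
Proof.
move=> oU; elim: n f => [|n IH] f H.
  apply: (Ck_eq oU _ (Ck_cst k U 0)) => x _; by rewrite big_ord0.
apply: (Ck_eq oU _ (Ck_add oU (IH _ (fun i => H (widen_ord (leqnSn n) i)))
  (H ord_max))) => x _.
by rewrite big_ord_recr.
Qed.

Lemma Ck_lin V W (W' : normedModType R) k (U : set V) (f : V -> W)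
    (L : {linear W -> W'}) : open U -> continuous L ->
  Ck k U f -> Ck k U (L \o f).
Proof.
move=> oU cL; elim: k f => [|k IH] f /=.
  by move=> Hf x Ux; apply: continuous_comp; [exact: Hf|exact: cL].
move=> [df Df]; split=> [x Ux|v].
  apply: differentiable_comp; first exact: df.
  exact: linear_differentiable.
apply: (Ck_eq oU _ (IH _ (Df v))) => x Ux /=.
have dL : differentiable L (f x) by exact: linear_differentiable.
have dfx := df x Ux.
have dc : differentiable (L \o f) x by exact: differentiable_comp.
by rewrite (deriveE _ dc) (deriveE _ dfx) (diff_comp dfx dL) /= diff_lin.
Qed.

Lemma Ck_mul V k (U : set V) (f g : V -> R^o) : open U ->
  Ck k U f -> Ck k U g -> Ck k U (fun x => f x * g x : R^o).
Proof.
move=> oU; elim: k f g => [|k IH] f g.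
  by move=> /= Hf Hg x Ux; apply: cvgM; [exact: Hf|exact: Hg].
move=> Hf Hg; have [df Df] := Hf; have [dg Dg] := Hg; split=> [x Ux|v].
  by apply: differentiableM; [exact: df|exact: dg].
apply: (Ck_eq oU _ (Ck_add oU (IH _ _ (Ck_pred Hf) (Dg v))
   (IH _ _ (Ck_pred Hg) (Df v)))) => x Ux.
rewrite deriveM//; apply: diff_derivable; [exact: df|exact: dg].
Qed.

Lemma Ck_coord V k n (U : set V) (f : V -> 'rV[R]_n) j : open U ->
  Ck k U f -> Ck k U (fun x => f x 0 j : R^o).
Proof.
move=> oU Hf.
have @L : {linear 'rV[R]_n -> R^o}.
  by exists (fun N : 'rV[R]_n => N 0 j); do 2![eexists]; do ?[constructor];
     rewrite ?mxE// => ? *; rewrite ?mxE//; move=> ?; rewrite !mxE.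
apply: (Ck_lin (L := L) oU _ Hf); exact: coord_continuous.
Qed.

Lemma Ck_scalel V W k (U : set V) (f : V -> R^o) (w : W) : open U ->
  Ck k U f -> Ck k U (fun x => f x *: w).
Proof.
move=> oU Hf.
have Llin : linear (fun a : R^o => a *: w).
  by move=> a u v; rewrite scalerDl -scalerA.
pose L : {linear R^o -> W} :=
  HB.pack (fun a : R^o => a *: w) (GRing.isLinear.Build _ _ _ _ _ Llin).
apply: (Ck_lin (L := L) oU _ Hf); exact: scalel_continuous.
Qed.

Lemma Ck_comp n m p k (U : set 'rV[R]_n) (U' : set 'rV[R]_m)
    (f : 'rV[R]_n -> 'rV[R]_m) (g : 'rV[R]_m -> 'rV[R]_p) :
  open U -> open U' -> (forall x, U x -> U' (f x)) ->
  Ck k U f -> Ck k U' g -> Ck k U (g \o f).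
Proof.
move=> oU oU' UU'; elim: k f g UU' => [|k IH] f g UU'.
  move=> Hf Hg x Ux; apply: continuous_comp; first exact: Hf.
  by apply: Hg; exact: UU'.
move=> Hf Hg; have [df Df] := Hf; have [dg Dg] := Hg; split=> [x Ux|v].
  by apply: differentiable_comp; [exact: df|apply: dg; exact: UU'].
have H : Ck k U (fun x => \sum_(j < m) \sum_(i < p)
    (('D_v f x) 0 j * ('D_(delta_mx 0 j) g (f x)) 0 i : R^o)
      *: (delta_mx 0 i : 'rV[R]_p)).
  apply: Ck_sum => // j; apply: Ck_sum => // i.
  apply: Ck_scalel => //; apply: Ck_mul => //.
    exact: Ck_coord (Df v).
  apply: (@Ck_coord _ _ _ _ (fun x => 'D_(delta_mx 0 j) g (f x))) => //.
  exact: (IH f (fun y => 'D_(delta_mx 0 j) g y) UU' (Ck_pred Hf) (Dg _)).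
apply: (Ck_eq oU _ H) => x Ux.
have dfx := df x Ux; have dgx := dg _ (UU' _ Ux).
have dc : differentiable (g \o f) x by exact: differentiable_comp.
rewrite (deriveE _ dc) (diff_comp dfx dgx) /= -(deriveE _ dfx).
rewrite [in RHS](row_sum_delta ('D_v f x)) linear_sum.
apply: eq_bigr => j _; rewrite linearZ /= -(deriveE _ dgx).
rewrite [in RHS](row_sum_delta ('D__ g _)) scaler_sumr; apply: eq_bigr => i _.
by rewrite scalerA.
Qed.

End CkTheory.

Record domain (R : realType) (n : nat) := Domain {
  dset :> set 'rV[R]_n;
  dset_open : open dset }.
Arguments dset_open {R n} d.

(* A map between domains is smooth when it is the restriction of a map of the
   ambient spaces that is C^k on the (open) source for every k; what the ambient
   map does outside the source is irrelevant. *)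
Definition dsmooth (R : realType) n m (U : domain R n) (V : domain R m)
    (F : U -> V) : Prop :=
  exists2 f : 'rV[R]_n -> 'rV[R]_m,
    forall x : U, f (\val x) = \val (F x) & forall k, Ck k U f.

Record param (R : realType) (n : nat) (X : Type) := Param {
  pdom : domain R n;
  pmap :> pdom -> X }.
Arguments Param {R n X pdom} pmap.

Definition pcomp (R : realType) n (X Y : Type) (h : X -> Y) (P : param R n X) :
  param R n Y := Param (h \o P).

Definition compatible (R : realType) n (X : Type) (S : set (param R n X)) :=
  forall Q Q', S Q -> S Q' ->
  forall (x : pdom Q) (y : pdom Q'), \val x = \val y -> Q x = Q' y.

(* A compatible family is given by the set of its members; P is the map on the
   union of their domains which restricts to each of them. *)
Definition is_supremum (R : realType) n (X : Type) (S : set (param R n X))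
    (P : param R n X) :=
  pdom P = \bigcup_(Q in S) pdom Q :> set 'rV[R]_n /\
  forall Q, S Q -> forall (x : pdom Q) (y : pdom P), \val x = \val y -> Q x = P y.

Record diffeology (R : realType) (X : Type) := Diffeology {
  dplot : forall n, set (param R n X);
  dplot_cover : forall x, exists n (P : param R n X) r, dplot P /\ P r = x;
  dplot_comp : forall n m (P : param R n X) (V : domain R m) (F : V -> pdom P),
    dplot P -> dsmooth F -> dplot (Param (P \o F));
  dplot_sup : forall n (S : set (param R n X)) (P : param R n X),
    S `<=` @dplot n -> compatible S -> is_supremum S P -> dplot P }.

Record diffSpace (R : realType) := DiffSpace {
  dcar :> Type;
  ddiff : diffeology R dcar }.

Definition isplot (R : realType) (X : diffSpace R) n (P : param R n X) : Prop :=
  dplot (ddiff X) P.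

Definition smooth (R : realType) (X Y : diffSpace R) (f : X -> Y) : Prop :=
  forall n (P : param R n X), isplot P -> isplot (X := Y) (pcomp f P).
Arguments smooth {R} X Y f.

Section Basics.
Context {R : realType}.
Implicit Types n m p : nat.

Lemma dsmooth_comp n m p (U : domain R n) (V : domain R m) (W : domain R p)
    (G : V -> W) (F : U -> V) : dsmooth G -> dsmooth F -> dsmooth (G \o F).
Proof.
move=> [g gE gC] [f fE fC]; exists (g \o f) => [x|k]; first by rewrite /= fE gE.
apply: (Ck_comp (dset_open U) (dset_open V) _ (fC k) (gC k)) => x Ux.
by rewrite (fE (SigSub (mem_set Ux))); exact: set_mem (valP _).
Qed.

Lemma Ck_id n k (U : domain R n) : Ck k U (id : 'rV[R]_n -> 'rV[R]_n).
Proof.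
pose L : {linear 'rV[R]_n -> 'rV[R]_n} := idfun.
have cL : continuous L by move=> x; exact: cvg_id.
elim: k => [|k IH]; first by move=> x _; exact: cvg_id.
split=> [x _|v]; first exact: (@linear_differentiable _ _ _ L x cL).
apply: (Ck_eq (dset_open U) _ (Ck_cst k U v)) => x _; rewrite derive_id//.
Qed.

Lemma dsmooth_incl n (U V : domain R n) (F : U -> V) :
  (forall x, \val (F x) = \val x) -> dsmooth F.
Proof. by move=> FE; exists id => [x|k] //; exact: Ck_id. Qed.

Lemma dsmooth_id n (U : domain R n) : dsmooth (id : U -> U).
Proof. exact: dsmooth_incl. Qed.

Lemma dsmooth_cst n m (U : domain R n) (V : domain R m) (v : V) :
  dsmooth (fun _ : U => v).
Proof. by exists (fun=> \val v) => // k; exact: Ck_cst. Qed.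

Definition dincl n (U V : domain R n) (UV : U `<=` V) (x : U) : V :=
  SigSub (mem_set (UV _ (set_mem (valP x)))).

Definition prestrict n (X : Type) (P : param R n X) (V : domain R n)
  (VP : V `<=` pdom P) : param R n X := Param (P \o dincl VP).

Lemma prestrict_sup n (X : Type) (S : set (param R n X)) P :
  is_supremum S P -> forall Q, S Q ->
  exists QP : pdom Q `<=` pdom P, prestrict QP = Q.
Proof.
move=> [dP SP] Q SQ.
have QP : pdom Q `<=` pdom P by rewrite dP => x Qx; exists Q.
exists QP; have := SP _ SQ; case: Q SQ QP => [V q] SQ QP qP.
by congr Param; apply/funext => x; exact: esym (qP x (dincl QP x) erefl).
Qed.

Lemma isplot_local (X : diffSpace R) n (P : param R n X) :
  (forall x : pdom P, exists V : domain R n, exists2 VP : V `<=` pdom P,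
     dset V (\val x) & isplot (X := X) (prestrict VP)) -> isplot P.
Proof.
move=> H.
pose S : set (param R n X) := [set Q | isplot (X := X) Q /\
  exists QP : pdom Q `<=` pdom P, Q = prestrict QP].
have SP Q : S Q -> forall (x : pdom Q) (y : pdom P), \val x = \val y -> Q x = P y.
  move=> [_ [QP QE]] x y xy; move: x xy; rewrite {}QE => x xy /=.
  by congr (P _); exact: val_inj.
apply: (dplot_sup (S := S)) => [Q []//|Q Q' SQ SQ' x y xy|].
  have [_ [QP _]] := SQ.
  by rewrite (SP _ SQ x (dincl QP x))// (SP _ SQ' y (dincl QP x)).
split=> //; apply/seteqP; split=> [x Px|x [Q [_ [QP _]]]]; last exact: QP.
have [V [VP Vx pV]] := H (SigSub (mem_set Px)).
by exists (prestrict VP) => //; split=> //; exists VP.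
Qed.

Lemma supremum_cover n (X : Type) (S : set (param R n X)) P (x : pdom P) :
  is_supremum S P -> exists2 Q, S Q & dset (pdom Q) (\val x).
Proof.
by move=> [dP _]; have := set_mem (valP x); move: (\val x) => y; rewrite dP.
Qed.

Lemma isplot_sup_local (X : diffSpace R) n (Y : Type)
    (S : set (param R n Y)) (P : param R n Y) (h : Y -> X) :
  is_supremum S P -> (forall Q, S Q -> isplot (X := X) (pcomp h Q)) ->
  isplot (X := X) (pcomp h P).
Proof.
move=> sP SX; apply: isplot_local => x /=.
have [Q SQ Qx] := supremum_cover (x : pdom P) sP; have [QP QE] := prestrict_sup sP SQ.
exists (pdom Q), QP => //; have := SX _ SQ; by rewrite -{1}QE.
Qed.

Lemma smooth_comp (X Y Z : diffSpace R) (g : Y -> Z) (f : X -> Y) :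
  smooth Y Z g -> smooth X Y f -> smooth X Z (g \o f).
Proof. by move=> gs fs n P /fs /gs. Qed.

Lemma smooth_id (X : diffSpace R) : smooth X X id.
Proof. by move=> n [U P]. Qed.

Section DomainSpace.
Context {m : nat} (V : domain R m).

Definition dom_plot n : set (param R n V) := [set P : param R n V | dsmooth P].

Lemma dom_cover (x : V) : exists n (P : param R n V) r, dom_plot P /\ P r = x.
Proof. by exists m, (Param (pdom := V) id), x; split=> //; exact: dsmooth_id. Qed.

Lemma dom_comp n p (P : param R n V) (W : domain R p) (F : W -> pdom P) :
  dom_plot P -> dsmooth F -> dom_plot (Param (P \o F)).
Proof. exact: dsmooth_comp. Qed.

Lemma dom_sup n (S : set (param R n V)) (P : param R n V) :
  S `<=` @dom_plot n -> compatible S -> is_supremum S P -> dom_plot P.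
Proof.
move=> SV _ sP.
pose f x := if pselect (dset (pdom P) x) is left Px then \val (P (SigSub (mem_set Px)))
            else 0.
have fE (x : pdom P) : f (\val x) = \val (P x).
  rewrite /f; case: pselect => [Px|/(_ (set_mem (valP x)))//].
  by congr (\val (P _)); exact: val_inj.
exists f => // k; apply: Ck_local => x; rewrite sP.1 => -[Q SQ Qx].
exists (dset (pdom Q)) => //; have [g gE gC] := SV _ SQ.
apply: (Ck_eq (dset_open _) _ (gC k)) => y Qy.
have Py : dset (pdom P) y by rewrite sP.1; exists Q.
rewrite (gE (SigSub (mem_set Qy))) (sP.2 _ SQ _ (SigSub (mem_set Py)))//.
by rewrite -fE.
Qed.

Definition domSp : diffSpace R := DiffSpace (Diffeology dom_cover dom_comp dom_sup).

End DomainSpace.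

Section ProductSpace.
Context (X Y : diffSpace R).

Definition prod_plot n : set (param R n (X * Y)) :=
  [set P | isplot (X := X) (pcomp fst P) /\ isplot (X := Y) (pcomp snd P)].

Lemma prod_cover xy : exists n (P : param R n (X * Y)) r, prod_plot P /\ P r = xy.
Proof.
have [n [P [r [pP Pr]]]] := dplot_cover (ddiff X) xy.1.
have [m [Q [s [pQ Qs]]]] := dplot_cover (ddiff Y) xy.2.
exists n, (Param (fun u : pdom P => (P r, Q s))), r; split; last first.
  by rewrite /= Pr Qs -surjective_pairing.
split; [exact: (dplot_comp pP (dsmooth_cst _ r))|].
exact: (dplot_comp pQ (dsmooth_cst _ s)).
Qed.

Lemma prod_comp n p (P : param R n (X * Y)) (W : domain R p) (F : W -> pdom P) :
  prod_plot P -> dsmooth F -> prod_plot (Param (P \o F)).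
Proof.
move=> [P1 P2] sF; split; first exact: (dplot_comp P1 sF).
exact: (dplot_comp P2 sF).
Qed.

Lemma prod_sup n (S : set (param R n (X * Y))) P :
  S `<=` @prod_plot n -> compatible S -> is_supremum S P -> prod_plot P.
Proof.
by move=> SV _ sP; split; apply: (isplot_sup_local sP) => Q /SV[].
Qed.

Definition prodSp : diffSpace R :=
  DiffSpace (Diffeology prod_cover prod_comp prod_sup).

End ProductSpace.

Lemma smooth_pair (X Y Z : diffSpace R) (f : X -> Y) (g : X -> Z) :
  smooth X Y f -> smooth X Z g -> smooth X (prodSp Y Z) (fun x => (f x, g x)).
Proof. by move=> fs gs n P Pp; split; [exact: fs|exact: gs]. Qed.

Lemma smooth_fst (X Y : diffSpace R) : smooth (prodSp X Y) X fst.
Proof. by move=> n P []. Qed.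

Lemma smooth_snd (X Y : diffSpace R) : smooth (prodSp X Y) Y snd.
Proof. by move=> n P []. Qed.

Lemma smooth_dom n m (U : domain R n) (V : domain R m) (F : U -> V) :
  dsmooth F -> smooth (domSp U) (domSp V) F.
Proof. by move=> sF p P; exact: dsmooth_comp. Qed.

Lemma smooth_plot (X : diffSpace R) n (P : param R n X) :
  isplot P <-> smooth (domSp (pdom P)) X P.
Proof.
split=> [pP m Q pQ|sP]; first exact: (dplot_comp pP pQ).
have := sP _ (Param (pdom := pdom P) id) (dsmooth_id _).
by case: P sP.
Qed.

Lemma smooth_cst (X Y : diffSpace R) (y : Y) : smooth X Y (fun=> y).
Proof.
move=> n P _; have [m [Q [s [pQ <-]]]] := dplot_cover (ddiff Y) y.
exact: (dplot_comp pQ (dsmooth_cst _ s)).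
Qed.

End Basics.

Record diffeo (R : realType) (X Y : diffSpace R) := Diffeo {
  dfwd :> X -> Y;
  dinv : Y -> X;
  dfwd_smooth : smooth X Y dfwd;
  dinv_smooth : smooth Y X dinv;
  dfwdK : cancel dfwd dinv;
  dinvK : cancel dinv dfwd }.
Arguments dfwd_smooth {R X Y} d.
Arguments dinv_smooth {R X Y} d.
Arguments dfwdK {R X Y} d.
Arguments dinvK {R X Y} d.

HB.instance Definition _ (R : realType) (X Y : diffSpace R) :=
  gen_eqMixin (diffeo X Y).
HB.instance Definition _ (R : realType) (X Y : diffSpace R) :=
  gen_choiceMixin (diffeo X Y).

Lemma diffeo_eq (R : realType) (X Y : diffSpace R) (f g : diffeo X Y) :
  f =1 g -> f = g.
Proof.
move=> fg; have {}fg : dfwd f = dfwd g by exact/funext.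
have ifg : dinv f = dinv g.
  by apply/funext => y; rewrite -[y in LHS](dinvK g) -fg dfwdK.
case: f fg ifg => f f' fs fs' fK f'K; case: g => g g' gs gs' gK g'K /= fg ifg.
move: fs fs' fK f'K; rewrite fg ifg => *; congr Diffeo; exact: Prop_irrelevance.
Qed.

Section DiffeoGroup.
Context {R : realType} (T : diffSpace R).
Implicit Types f g h : diffeo T T.

Definition diffeo1 : diffeo T T :=
  Diffeo (@smooth_id R T) (@smooth_id R T) (fun=> erefl) (fun=> erefl).
Definition diffeoV f : diffeo T T :=
  Diffeo (dinv_smooth f) (dfwd_smooth f) (dinvK f) (dfwdK f).
Definition diffeoM f g : diffeo T T :=
  Diffeo (smooth_comp (dfwd_smooth f) (dfwd_smooth g))
         (smooth_comp (dinv_smooth g) (dinv_smooth f))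
         (can_comp (dfwdK f) (dfwdK g)) (can_comp (dinvK g) (dinvK f)).

Lemma diffeoA : associative diffeoM. Proof. by move=> f g h; exact: diffeo_eq. Qed.
Lemma diffeo1M : left_id diffeo1 diffeoM. Proof. by move=> f; exact: diffeo_eq. Qed.
Lemma diffeoM1 : right_id diffeo1 diffeoM. Proof. by move=> f; exact: diffeo_eq. Qed.
Lemma diffeoVM : left_inverse diffeo1 diffeoV diffeoM.
Proof. by move=> f; apply: diffeo_eq => t; exact: dfwdK. Qed.
Lemma diffeoMV : right_inverse diffeo1 diffeoV diffeoM.
Proof. by move=> f; apply: diffeo_eq => t; exact: dinvK. Qed.

HB.instance Definition _ :=
  isGroup.Build (diffeo T T) diffeoA diffeo1M diffeoM1 diffeoVM diffeoMV.

End DiffeoGroup.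

Record diffGroup (R : realType) := DiffGroup {
  gcar :> groupType;
  gdiff : diffeology R gcar;
  gmul_smooth : smooth (prodSp (DiffSpace gdiff) (DiffSpace gdiff))
    (DiffSpace gdiff) (fun xy => (xy.1 * xy.2)%g);
  ginv_smooth : smooth (DiffSpace gdiff) (DiffSpace gdiff) (fun x => (x^-1)%g) }.
Arguments gmul_smooth {R} d.
Arguments ginv_smooth {R} d.

Coercion gspace (R : realType) (G : diffGroup R) : diffSpace R :=
  DiffSpace (gdiff G).

Section DiffeoSpace.
Context {R : realType} (T : diffSpace R).

Definition diffeo_plot n : set (param R n (diffeo T T)) :=
  [set P : param R n (diffeo T T) |
  smooth (prodSp (domSp (pdom P)) T) T (fun rt => P rt.1 rt.2) /\
  smooth (prodSp (domSp (pdom P)) T) T (fun rt => dinv (P rt.1) rt.2)].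

Lemma diffeo_cover f :
  exists n (P : param R n (diffeo T T)) r, diffeo_plot P /\ P r = f.
Proof.
pose U : domain R 0 := Domain openT.
exists 0%N, (Param (fun _ : U => f)), (SigSub (mem_set (I : dset U 0))).
split=> //; split; first exact: smooth_comp (dfwd_smooth f) (@smooth_snd _ _ _).
exact: smooth_comp (dinv_smooth f) (@smooth_snd _ _ _).
Qed.

Lemma diffeo_comp n p (P : param R n (diffeo T T)) (W : domain R p)
    (F : W -> pdom P) :
  diffeo_plot P -> dsmooth F -> diffeo_plot (Param (P \o F)).
Proof.
move=> [P1 P2] sF.
have sFT : smooth (prodSp (domSp W) T) (prodSp (domSp (pdom P)) T)
    (fun rt => (F rt.1, rt.2)).
  apply: smooth_pair; last exact: smooth_snd.
  by apply: (smooth_comp (smooth_dom sF)); exact: smooth_fst.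
by split; [exact: (smooth_comp P1 sFT)|exact: (smooth_comp P2 sFT)].
Qed.

Lemma diffeo_sup_aux n (S : set (param R n (diffeo T T))) P
    (ev : diffeo T T -> T -> T) :
  (forall Q, S Q ->
     smooth (prodSp (domSp (pdom Q)) T) T (fun rt => ev (Q rt.1) rt.2)) ->
  is_supremum S P ->
  smooth (prodSp (domSp (pdom P)) T) T (fun rt => ev (P rt.1) rt.2).
Proof.
move=> SV sP m A [A1 A2]; apply: isplot_local => x /=.
have [Q SQ Qx] := supremum_cover (A x).1 sP.
have [a aE aC] := A1.
have oW : open (pdom A `&` a @^-1` pdom Q).
  rewrite openE => y [Ay Qy]; apply: filterI.
    by apply: open_nbhs_nbhs; split=> //; exact: dset_open.
  have /= ac := aC 0%N y Ay.
  by apply: ac; apply: open_nbhs_nbhs; split=> //; exact: dset_open.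
pose W := Domain oW.
have WA : W `<=` pdom A by move=> y [].
exists W, WA; first by split; [exact: set_mem (valP x)|rewrite /preimage/= aE].
have WQ (y : W) : dset (pdom Q) (\val (A (dincl WA y)).1).
  have [_] := set_mem (valP y); rewrite /preimage /=.
  by rewrite (aE (dincl WA y)).
pose B : param R m (pdom Q * T) :=
  Param (fun y : W => (SigSub (mem_set (WQ y)), (A (dincl WA y)).2)).
have pB : isplot (X := prodSp (domSp (pdom Q)) T) B.
  split; first by exists a => [y|k]; [exact: (aE (dincl WA y))|exact: Ck_sub (aC k)].
  have sI : dsmooth (dincl WA) by exact: dsmooth_incl.
  exact: (dplot_comp A2 sI).
have := SV _ SQ _ _ pB; congr (isplot (X := T) _).
rewrite /pcomp /prestrict /=; congr Param; apply/funext => y /=.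
by congr (ev _ _); apply: (sP.2 _ SQ).
Qed.

Lemma diffeo_sup n (S : set (param R n (diffeo T T))) P :
  S `<=` @diffeo_plot n -> compatible S -> is_supremum S P -> diffeo_plot P.
Proof.
move=> SV _ sP; split.
- by apply: (diffeo_sup_aux (ev := @dfwd R T T) _ sP) => Q /SV[].
- by apply: (diffeo_sup_aux (ev := @dinv R T T) _ sP) => Q /SV[].
Qed.

Definition diffeo_diffeology := Diffeology diffeo_cover diffeo_comp diffeo_sup.

Lemma diffeo_mul_smooth : smooth (prodSp (DiffSpace diffeo_diffeology) (DiffSpace diffeo_diffeology))
  (DiffSpace diffeo_diffeology) (fun xy => (xy.1 * xy.2)%g).
Proof.
move=> n P [[P1 P1'] [P2 P2']].
have sub (p : pdom P -> T -> T) : smooth (prodSp (domSp (pdom P)) T) T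
      (fun rt => p rt.1 rt.2) ->
    smooth (prodSp (domSp (pdom P)) T) (prodSp (domSp (pdom P)) T)
      (fun rt => (rt.1, p rt.1 rt.2)).
  by move=> sp; exact: smooth_pair (@smooth_fst _ _ _) sp.
split.
- exact: (smooth_comp P1 (sub (fun r => dfwd (P r).2) P2)).
- exact: (smooth_comp P2' (sub (fun r => dinv (P r).1) P1')).
Qed.

Lemma diffeo_inv_smooth : smooth (DiffSpace diffeo_diffeology) (DiffSpace diffeo_diffeology)
  (fun x => (x^-1)%g).
Proof. by move=> n P [P1 P2]. Qed.

Definition DiffT : diffGroup R := DiffGroup diffeo_mul_smooth diffeo_inv_smooth.

End DiffeoSpace.

Record plot (R : realType) (X : diffSpace R) := Plot {
  pldim : nat;
  plpar :> param R pldim X;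
  plotP : isplot plpar }.

Record morph (R : realType) (X : diffSpace R) (Q P : plot X) := Morph {
  mfun :> pdom Q -> pdom P;
  mfun_smooth : dsmooth mfun;
  mfunE : forall r, P (mfun r) = Q r }.
Arguments mfun_smooth {R X Q P} m.
Arguments mfunE {R X Q P} m r.

Definition mcomp (R : realType) (X : diffSpace R) (P Q S : plot X)
  (F : morph Q P) (G : morph S Q) : morph S P :=
  Morph (dsmooth_comp (mfun_smooth F) (mfun_smooth G))
    (fun r => etrans (mfunE F (G r)) (mfunE G r)).

Record covgen (R : realType) (X : diffSpace R) := CovGen {
  cfam :> set (plot X);
  cfam_cover : forall x : X,
    exists (P : plot X) (r : pdom P), cfam P /\ P r = x;
  cfam_gen : forall n (Q : param R n X), isplot Q ->
    exists S : set (param R n X), [/\ compatible S, is_supremum S Q &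
      forall Q', S Q' -> exists (P : plot X) (F : pdom Q' -> pdom P),
        [/\ cfam P, dsmooth F & forall r, Q' r = P (F r)]] }.

(* simplex1 P0 P1 is the type of diagrams P0 <-F1- Q -F0-> P1. *)
Record simplex1 (R : realType) (X : diffSpace R) (P0 P1 : plot X) := Simplex1 {
  s1Q : plot X;
  s1F1 : morph s1Q P0;
  s1F0 : morph s1Q P1 }.

Record simplex2 (R : realType) (X : diffSpace R) (P0 P1 P2 : plot X) := Simplex2 {
  s2S2 : simplex1 P0 P1;
  s2S1 : simplex1 P0 P2;
  s2S0 : simplex1 P1 P2;
  s2Q : plot X;
  s2F2 : morph s2Q (s1Q s2S2);
  s2F1 : morph s2Q (s1Q s2S1);
  s2F0 : morph s2Q (s1Q s2S0);
  s2E12 : forall r, s1F1 s2S1 (s2F1 r) = s1F1 s2S2 (s2F2 r);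
  s2E02 : forall r, s1F1 s2S0 (s2F0 r) = s1F0 s2S2 (s2F2 r);
  s2E01 : forall r, s1F0 s2S0 (s2F0 r) = s1F0 s2S1 (s2F1 r) }.

(* refinement C' C: data exhibiting C' as a refinement of C. *)
Record refinement (R : realType) (X : diffSpace R) (C' C : covgen X) := Refinement {
  rmap :> C' -> C;
  rmor : forall b : C', morph (\val b) (\val (rmap b)) }.

(* The set of classes of a relation, to be used with equivalence relations. The
   classes are plain predicates because bundles live in a universe too large for
   [set]. *)
Definition quotient (T : Type) (e : T -> T -> Prop) :=
  {A : T -> Prop | exists x, A = e x}.

Definition cls (T : Type) (e : T -> T -> Prop) (x : T) : quotient e :=
  exist _ (e x) (ex_intro _ x erefl).

Definition qrepr (T : Type) (e : T -> T -> Prop) (A : quotient e) : T :=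
  projT1 (cid (svalP A)).

Lemma quotient_eq (T : Type) (e : T -> T -> Prop) (A B : quotient e) :
  sval A = sval B -> A = B.
Proof.
by case: A B => [A Ae] [B Be] /= AB; move: Be; rewrite -AB => Be; congr exist.
Qed.

Lemma qreprK (T : Type) (e : T -> T -> Prop) (A : quotient e) :
  cls e (qrepr A) = A.
Proof. by apply: quotient_eq; rewrite [RHS](projT2 (cid (svalP A))). Qed.

Record cocycle (R : realType) (X : diffSpace R) (G : diffGroup R)
    (C : covgen X) := Cocycle {
  cfun :> forall P0 P1 : C, forall s : simplex1 (\val P0) (\val P1),
    pdom (s1Q s) -> G;
  cfun_smooth : forall (P0 P1 : C) (s : simplex1 (\val P0) (\val P1)),
    smooth (domSp (pdom (s1Q s))) G (@cfun _ _ s);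
  cfunM : forall (P0 P1 P2 : C) (s : simplex2 (\val P0) (\val P1) (\val P2)),
    forall r : pdom (s2Q s),
    (@cfun _ _ (s2S2 s) (s2F2 s r) * @cfun _ _ (s2S0 s) (s2F0 s r))%g =
    @cfun _ _ (s2S1 s) (s2F1 s r) }.
Arguments cfun {R X G C} c P0 P1 s r : rename.
Arguments cfun_smooth {R X G C} c {P0 P1} s.
Arguments cfunM {R X G C} c {P0 P1 P2} s r.

Definition cohomologous (R : realType) (X : diffSpace R) (G : diffGroup R)
    (C : covgen X) (g g' : cocycle G C) : Prop :=
  exists h : forall P : C, pdom (\val P) -> G,
    (forall P : C, smooth (domSp (pdom (\val P))) G (h P)) /\
    forall (P0 P1 : C) (s : simplex1 (\val P0) (\val P1)) (r : pdom (s1Q s)),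
      (g' _ _ s r * h P1 (s1F0 s r))%g = (h P0 (s1F1 s r) * g _ _ s r)%g.

Definition CechH1on (R : realType) (X : diffSpace R) (G : diffGroup R)
  (C : covgen X) := quotient (@cohomologous R X G C).

Section Cech.
Context {R : realType} {X : diffSpace R} {G : diffGroup R}.
Implicit Types C : covgen X.

(* A refinement C' of C turns 1-simplices on C' into 1-simplices on C, hence
   restricts cocycles on C to cocycles on C'. *)
Definition rsimplex C' C (l : refinement C' C) (b0 b1 : C')
    (s : simplex1 (\val b0) (\val b1)) : simplex1 (\val (l b0)) (\val (l b1)) :=
  Simplex1 (mcomp (rmor l b0) (s1F1 s)) (mcomp (rmor l b1) (s1F0 s)).

Lemma rcocycleM C' C (l : refinement C' C) (g : cocycle G C) (b0 b1 b2 : C')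
    (s : simplex2 (\val b0) (\val b1) (\val b2)) (r : pdom (s2Q s)) :
  (g _ _ (rsimplex l (s2S2 s)) (s2F2 s r) *
   g _ _ (rsimplex l (s2S0 s)) (s2F0 s r))%g =
  g _ _ (rsimplex l (s2S1 s)) (s2F1 s r).
Proof.
have E12 r' : s1F1 (rsimplex l (s2S1 s)) (s2F1 s r') =
              s1F1 (rsimplex l (s2S2 s)) (s2F2 s r') by rewrite /= s2E12.
have E02 r' : s1F1 (rsimplex l (s2S0 s)) (s2F0 s r') =
              s1F0 (rsimplex l (s2S2 s)) (s2F2 s r') by rewrite /= s2E02.
have E01 r' : s1F0 (rsimplex l (s2S0 s)) (s2F0 s r') =
              s1F0 (rsimplex l (s2S1 s)) (s2F1 s r') by rewrite /= s2E01.
exact: (cfunM g (@Simplex2 _ _ _ _ _ (rsimplex l (s2S2 s)) (rsimplex l (s2S1 s))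
  (rsimplex l (s2S0 s)) (s2Q s) (s2F2 s) (s2F1 s) (s2F0 s) E12 E02 E01) r).
Qed.

Definition rcocycle C' C (l : refinement C' C) (g : cocycle G C) : cocycle G C' :=
  @Cocycle R X G C' (fun _ _ s => g _ _ (rsimplex l s))
    (fun _ _ s => cfun_smooth g (rsimplex l s)) (rcocycleM l g).

(* The map j(C', C) : H^1(X, C, G) -> H^1(X, C', G); by jmapE below it does not
   depend on the representative used to define it. *)
Definition jmap C' C (l : refinement C' C) (a : CechH1on G C) : CechH1on G C' :=
  cls _ (rcocycle l (qrepr a)).

Lemma smooth_mulg (Y : diffSpace R) (f g : Y -> G) : smooth Y G f ->
  smooth Y G g -> smooth Y G (fun y => f y * g y)%g.
Proof.
by move=> fs gs; exact: smooth_comp (gmul_smooth G) (smooth_pair fs gs).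
Qed.

Lemma smooth_invg (Y : diffSpace R) (f : Y -> G) : smooth Y G f ->
  smooth Y G (fun y => (f y)^-1)%g.
Proof. by move=> fs; exact: smooth_comp (ginv_smooth G) fs. Qed.

Lemma cohomologous_refl C (g : cocycle G C) : cohomologous g g.
Proof.
exists (fun _ _ => 1%g); split=> [P|P0 P1 s r]; first exact: smooth_cst.
by rewrite mulg1 mul1g.
Qed.

Lemma cohomologous_sym C (g g' : cocycle G C) :
  cohomologous g g' -> cohomologous g' g.
Proof.
move=> [h [hs hE]]; exists (fun P r => (h P r)^-1)%g; split=> [P|P0 P1 s r].
  exact: smooth_invg.
apply: (mulgI (h P0 (s1F1 s r))).
by rewrite !mulgA -hE mulgK mulgV mul1g.
Qed.

Lemma cohomologous_trans C (g g' g'' : cocycle G C) :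
  cohomologous g g' -> cohomologous g' g'' -> cohomologous g g''.
Proof.
move=> [h [hs hE]] [k [ks kE]]; exists (fun P r => k P r * h P r)%g.
split=> [P|P0 P1 s r]; first exact: smooth_mulg.
by rewrite mulgA kE -mulgA hE mulgA.
Qed.

Lemma rcocycle_cohomologous C' C (l : refinement C' C) (g g' : cocycle G C) :
  cohomologous g g' -> cohomologous (rcocycle l g) (rcocycle l g').
Proof.
move=> [h [hs hE]]; exists (fun b r => h (l b) (rmor l b r)); split=> [b|b0 b1 s r].
  exact: (smooth_comp (hs _) (smooth_dom (mfun_smooth _))).
exact: (hE _ _ (rsimplex l s) r).
Qed.

Lemma cls_cohomologous C (g g' : cocycle G C) :
  cls (@cohomologous _ _ _ C) g = cls _ g' <-> cohomologous g g'.
Proof.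
split=> [[gg']|gg'].
  by rewrite gg'; exact: cohomologous_refl.
apply: quotient_eq; apply/funext => k; apply/propext; split;
  apply: cohomologous_trans => //; exact: cohomologous_sym.
Qed.

Lemma jmapE C' C (l : refinement C' C) (g : cocycle G C) :
  jmap l (cls _ g) = cls _ (rcocycle l g).
Proof.
apply/cls_cohomologous/rcocycle_cohomologous/cls_cohomologous; exact: qreprK.
Qed.

End Cech.

(* The direct limit of the sets H^1(X, C, G): elements of two of them are
   identified when they have the same image in the set attached to some common
   refinement. *)
Definition cech_eq (R : realType) (X : diffSpace R) (G : diffGroup R)
    (a b : {C : covgen X & CechH1on G C}) : Prop :=
  exists (C : covgen X) (l : refinement C (tag a)) (l' : refinement C (tag b)),
    jmap l (tagged a) = jmap l' (tagged b).

Definition CechH1 (R : realType) (X : diffSpace R) (G : diffGroup R) :=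
  quotient (@cech_eq R X G).

Definition cech_class (R : realType) (X : diffSpace R) (G : diffGroup R)
    (C : covgen X) (g : cocycle G C) : CechH1 X G :=
  cls _ (Tagged (CechH1on G) (cls _ g)).

(* The commutative square
       A --q--> E
       |p       |pi
       v        v
       B --f--> X
   is a pullback in the category of diffeological spaces. *)
Definition is_pullback (R : realType) (A B E X : diffSpace R)
    (p : A -> B) (q : A -> E) (f : B -> X) (pi : E -> X) : Prop :=
  (forall a, pi (q a) = f (p a)) /\
  forall (Z : diffSpace R) (b : Z -> B) (e : Z -> E),
    smooth Z B b -> smooth Z E e -> (forall z, pi (e z) = f (b z)) ->
    exists! u : Z -> A,
      [/\ smooth Z A u, forall z, p (u z) = b z & forall z, q (u z) = e z].

Record bundle (R : realType) (X T : diffSpace R) (G : diffGroup R)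
    (rho : G -> DiffT T) := Bundle {
  btot : diffSpace R;
  bproj : btot -> X;
  bproj_smooth : smooth btot X bproj;
  bfam : covgen X;
  btriv : forall P : bfam, pdom (\val P) * T -> btot;
  btriv_smooth : forall P : bfam,
    smooth (prodSp (domSp (pdom (\val P))) T) btot (@btriv P);
  btriv_pullback : forall P : bfam,
    is_pullback (A := prodSp (domSp (pdom (\val P))) T)
      (B := domSp (pdom (\val P))) fst (@btriv P) (\val P) bproj;
  btrans : forall P0 P1 : bfam, forall s : simplex1 (\val P0) (\val P1),
    pdom (s1Q s) -> G;
  btrans_smooth : forall (P0 P1 : bfam) (s : simplex1 (\val P0) (\val P1)),
    smooth (domSp (pdom (s1Q s))) G (@btrans _ _ s);
  btransE : forall (P0 P1 : bfam) (s : simplex1 (\val P0) (\val P1)) r t,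
    @btriv P1 (s1F0 s r, t) = @btriv P0 (s1F1 s r, dfwd (rho (@btrans _ _ s r)) t) }.
Arguments bproj {R X T G rho} b e : rename.
Arguments btriv {R X T G rho} b P rt : rename.
Arguments btrans {R X T G rho} b P0 P1 s r : rename.

Definition bundle_iso (R : realType) (X T : diffSpace R) (G : diffGroup R)
    (rho : G -> DiffT T) (B B' : bundle X rho) : Prop :=
  exists Phi : diffeo (btot B) (btot B'),
    (forall e, bproj B' (Phi e) = bproj B e) /\
    exists (C : covgen X) (l : refinement C (bfam B)) (l' : refinement C (bfam B')),
    forall b : C, exists h : pdom (\val b) -> G,
      smooth (domSp (pdom (\val b))) G h /\
      forall r t, Phi (btriv B (l b) (rmor l b r, t)) =
                  btriv B' (l' b) (rmor l' b r, dfwd (rho (h r)) t).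

Definition Bund (R : realType) (X T : diffSpace R) (G : diffGroup R)
  (rho : G -> DiffT T) := quotient (@bundle_iso R X T G rho).

(* Main.v *)
Require Import Defs.
From mathcomp Require Import all_boot all_order all_algebra.
From mathcomp Require Import boolp classical_sets reals.
From mathcomp Require Import topology normedtype.
Set Implicit Arguments.
Unset Strict Implicit.
Unset Printing Implicit Defensive.
Import numFieldNormedType.Exports.
Local Open Scope classical_set_scope.

(** A cocycle turns out to be a function of pairs of points. Restricting a
1-simplex to a single point of its source and using that a cocycle is natural in
the source ([cocycle_natural]), the value of g at r in dom Q depends only on the
points F1(r) and F0(r): it is [cval g (F1 r) (F0 r)], where cval is defined for
any two points of plots of C over the same point of X and is multiplicative
([cvalM]). So a cocycle is a morphism to G from the groupoid of pairs of points
of the plots lying over the same point of X, which is smooth along pairs of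
smooth maps ([cval_smooth]). Two refinement maps then give cohomologous
restrictions, the cochain being the value of g between the two image points
([rcocycle_indep]); since two covering generating families have a common
refinement, made of all plots that factor through both ([common_refinement]),
being cohomologous on some common refinement is an equivalence relation, whose
classes are the elements of the direct limit ([cech_class_eq]).

From a cocycle g the total space is built on the set X * T itself, without a
quotient: choose over each x of X a base point of some plot of C, and let
P in C trivialize by (r, t) |-> (P r, rho (g from the base point to r) t).
The plots of X * T are the parametrizations with a smooth projection to X and
smooth coordinates along every smooth lift to a plot of C. This is a bundle with
transitions g ([assoc_bundle]).

Conversely the transitions of any bundle form a cocycle ([bcocycle]), as the
trivializations are injective on fibers and rho is faithful; and two
bundles are isomorphic exactly when their cocycles are cohomologous on a common
refinement ([iso_of_cech], [cech_of_iso]), the cochain h being the isomorphism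
read in the trivializations. Hence Theta, which sends the class of g to the class
of its bundle, and the map which sends a bundle to the class of its transitions,
are well defined and inverse to each other. *)

(** * Local lifts and common refinements *)

Section Refinements.
Context {R : realType}.

(** Smooth maps of domains are continuous, so the preimage of an open set can
serve as a domain. *)
Lemma dsmooth_corestrict n m (V : domain R m) (U U' : domain R n) (K : V -> U)
    (x : V) : dsmooth K -> dset U' (\val (K x)) ->
  exists (W : domain R m) (WV : W `<=` V) (K' : W -> U'),
    [/\ dset W (\val x), dsmooth K' & forall w, \val (K' w) = \val (K (dincl WV w))].
Proof.
move=> [k kE kC] U'x.
have oW : open (V `&` k @^-1` U').
  rewrite openE => y [Vy U'y]; apply: filterI.
    by apply: open_nbhs_nbhs; split=> //; exact: dset_open.
  have /= kc := kC 0%N y Vy.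
  by apply: kc; apply: open_nbhs_nbhs; split=> //; exact: dset_open.
pose W := Domain oW.
have WV : W `<=` V by move=> y [].
have WU (w : W) : dset U' (\val (K (dincl WV w))).
  by have [_] := set_mem (valP w); rewrite /preimage /= -kE.
exists W, WV, (fun w => SigSub (mem_set (WU w))); split=> //.
  by split; [exact: set_mem (valP x)|rewrite /preimage/= kE].
by exists k => [w|i]; [exact: (kE (dincl WV w))|exact: Ck_sub (kC i)].
Qed.

Definition factors (X : diffSpace R) (C : covgen X) n (Q : param R n X) : Prop :=
  exists (P : C) (F : pdom Q -> pdom (\val P)),
    dsmooth F /\ forall r, \val P (F r) = Q r.

Lemma locally_factors (X : diffSpace R) (C : covgen X) n (Q : param R n X)
    (x : pdom Q) : isplot Q ->
  exists (V : domain R n) (VQ : V `<=` pdom Q),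
    dset V (\val x) /\ factors C (prestrict VQ).
Proof.
move=> /(cfam_gen C)[S [_ sS SC]].
have [Q' SQ' Qx] := supremum_cover x sS; have [QP QE] := prestrict_sup sS SQ'.
exists (pdom Q'), QP; split=> //; have [P [F [CP sF FE]]] := SC _ SQ'.
exists (SigSub (mem_set CP)); rewrite QE.
by exists F; split=> // r; rewrite FE.
Qed.

Lemma factors_restrict (X : diffSpace R) (C : covgen X) n (Q : param R n X)
    (V : domain R n) (VQ : V `<=` pdom Q) :
  factors C Q -> factors C (prestrict VQ).
Proof.
move=> [P [F [sF FE]]]; exists P, (F \o dincl VQ); split=> [|r]; last exact: FE.
by apply: (dsmooth_comp sF); exact: dsmooth_incl.
Qed.

Lemma prestrict_isplot (X : diffSpace R) n (Q : param R n X)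
    (V : domain R n) (VQ : V `<=` pdom Q) : isplot Q -> isplot (X := X) (prestrict VQ).
Proof. by move=> pQ; apply: (dplot_comp pQ); exact: dsmooth_incl. Qed.

Section Points.
Context {X : diffSpace R}.

Definition pt_dom : domain R 0 := Domain openT.
Definition pt : pt_dom := SigSub (mem_set (I : dset pt_dom 0%R)).

Lemma pt_isplot (x : X) : isplot (X := X) (Param (fun _ : pt_dom => x)).
Proof. by apply/smooth_plot; exact: smooth_cst. Qed.

(** A point of X seen as a plot of dimension 0: a point of a plot over x is then a
morphism from [ptplot x], which lets 1-simplices be evaluated pointwise. *)
Definition ptplot (x : X) : plot X := Plot (pt_isplot x).

Definition ptmorph (P : plot X) (a : pdom P) (x : X) (e : P a = x) :
  morph (ptplot x) P := @Morph _ _ (ptplot x) _ _ (dsmooth_cst pt_dom a) (fun _ => e).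

Definition ptsimplex (P0 P1 : plot X) (a0 : pdom P0) (a1 : pdom P1)
  (e : P0 a0 = P1 a1) : simplex1 P0 P1 := Simplex1 (ptmorph e) (ptmorph erefl).

Lemma factors_morph (C : covgen X) (Q : plot X) : factors C Q ->
  exists P : C, exists F : morph Q (\val P), True.
Proof. by move=> [P [F [sF FE]]]; exists P, (Morph sF FE). Qed.

(** The largest common refinement of C and C': all the plots that factor through
both families. It generates because a plot factors through C near any point and
the restriction obtained factors through C' on a smaller neighborhood. *)
Section CommonRefinement.
Context (C C' : covgen X).

Definition common : set (plot X) :=
  [set Q : plot X | factors C Q /\ factors C' Q].

Lemma common_cover x : exists (P : plot X) (r : pdom P), common P /\ P r = x.
Proof.
have fx (D : covgen X) : factors D (ptplot x).
  have [P [r [DP Pr]]] := cfam_cover D x; exists (SigSub (mem_set DP)).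
  by exists (fun=> r); split=> //; exact: dsmooth_cst.
by exists (ptplot x), pt.
Qed.

Lemma common_gen n (Q : param R n X) : isplot Q ->
  exists S : set (param R n X), [/\ compatible S, is_supremum S Q &
    forall Q', S Q' -> exists (P : plot X) (F : pdom Q' -> pdom P),
      [/\ common P, dsmooth F & forall r, Q' r = P (F r)]].
Proof.
move=> pQ.
pose S : set (param R n X) := [set Q' | (factors C Q' /\ factors C' Q') /\
  exists QP : pdom Q' `<=` pdom Q, Q' = prestrict QP].
have SQ Q' : S Q' -> forall (x : pdom Q') (y : pdom Q), \val x = \val y -> Q' x = Q y.
  move=> [_ [QP QE]] x y xy; move: x xy; rewrite {}QE => x xy /=.
  by congr (Q _); exact: val_inj.
exists S; split.
- move=> Q1 Q2 S1 S2 x y xy; have [_ [QP _]] := S1.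
  by rewrite (SQ _ S1 x (dincl QP x))// (SQ _ S2 y (dincl QP x)).
- split=> //; apply/seteqP; split=> [x Qx|x [Q' [_ [QP _]]]]; last exact: QP.
  have [V [VQ [Vx VC]]] := locally_factors C (SigSub (mem_set Qx)) pQ.
  have [W [WV [Wx WC]]] := locally_factors C' (SigSub (mem_set Vx) : pdom (prestrict VQ))
    (prestrict_isplot VQ pQ).
  exists (prestrict WV) => //; split.
    by split=> //; exact: factors_restrict.
  exists (subset_trans WV VQ); congr Param; apply/funext => w /=.
  by congr (Q _); exact: val_inj.
- move=> Q' [fQ' [QP QE]].
  have pQ' : isplot (X := X) Q' by rewrite QE; exact: prestrict_isplot.
  by exists (Plot pQ'), id; split=> //; exact: dsmooth_id.
Qed.

Definition common_covgen : covgen X := CovGen common_cover common_gen.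

Lemma common_refinement :
  exists (D : covgen X) (l : refinement D C) (l' : refinement D C'), True.
Proof.
have aux (C0 : covgen X) : (forall b : common_covgen, factors C0 (\val b)) ->
    exists l : refinement common_covgen C0, True.
  move=> H; pose L b := cid (factors_morph (H b)).
  by exists (Refinement (fun b => projT1 (cid (projT2 (L b))))).
have [|l _] := aux C; first by move=> b; have [] := set_mem (valP b).
have [|l' _] := aux C'; first by move=> b; have [] := set_mem (valP b).
by exists common_covgen, l, l'.
Qed.

End CommonRefinement.
End Points.
End Refinements.

(** * Cocycles as functions of pairs of points *)

Section CocycleValues.
Context {R : realType} {X : diffSpace R} {G : diffGroup R}.
Implicit Types C : covgen X.

Definition morph_id (Q : plot X) : morph Q Q :=
  Morph (@dsmooth_id _ _ (pdom Q)) (fun=> erefl).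

(** The cocycle relation on the degenerate 2-simplex reads x * x = x. *)
Lemma cocycle_diag C (g : cocycle G C) (P : C) (Q : plot X) (F : morph Q (\val P)) r :
  g P P (Simplex1 F F) r = 1%g.
Proof.
pose s := @Simplex2 R X _ _ _ (Simplex1 F F) (Simplex1 F F) (Simplex1 F F) Q
  (morph_id Q) (morph_id Q) (morph_id Q) (fun=> erefl) (fun=> erefl) (fun=> erefl).
apply: (mulgI (g P P (Simplex1 F F) r)); rewrite mulg1.
exact: (cfunM g s r).
Qed.

(** The 2-simplex with faces s (along K), s' and the degenerate simplex on its
second leg compares the two values. *)
Lemma cocycle_natural C (g : cocycle G C) (P0 P1 : C)
    (s s' : simplex1 (\val P0) (\val P1)) (K : morph (s1Q s') (s1Q s)) r :
  (forall r, s1F1 s' r = s1F1 s (K r)) -> (forall r, s1F0 s' r = s1F0 s (K r)) ->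
  g _ _ s' r = g _ _ s (K r).
Proof.
move=> E1 E0.
pose u := @Simplex2 R X _ _ _ s s' (Simplex1 (s1F0 s') (s1F0 s')) (s1Q s')
  K (morph_id _) (morph_id _) E1 E0 (fun=> erefl).
by rewrite -[LHS](cfunM g u r) /= cocycle_diag mulg1.
Qed.

(** The test on the two points makes [cval] total, so that no proof that they lie
over the same point occurs in terms; the value 1 is junk. *)
Definition cval C (g : cocycle G C) (P0 P1 : C) (a0 : pdom (\val P0))
    (a1 : pdom (\val P1)) : G :=
  if pselect (\val P0 a0 = \val P1 a1) is left e then g P0 P1 (ptsimplex e) pt
  else 1%g.

Lemma simplex1E (P0 P1 : plot X) (s : simplex1 P0 P1) r :
  P0 (s1F1 s r) = P1 (s1F0 s r).
Proof. by rewrite !mfunE. Qed.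

(** Naturality along the inclusion of the point r in the source of s. *)
Lemma cocycle_cval C (g : cocycle G C) (P0 P1 : C)
    (s : simplex1 (\val P0) (\val P1)) r :
  g _ _ s r = cval g (s1F1 s r) (s1F0 s r).
Proof.
rewrite /cval; case: pselect => [e|[]]; last exact: simplex1E.
symmetry; apply: (@cocycle_natural _ _ _ _ s (ptsimplex e)
  (ptmorph (esym (mfunE (s1F0 s) r)))) => // x.
Qed.

Lemma cvalM C (g : cocycle G C) (P0 P1 P2 : C) (a0 : pdom (\val P0))
    (a1 : pdom (\val P1)) (a2 : pdom (\val P2)) :
  \val P0 a0 = \val P1 a1 -> \val P1 a1 = \val P2 a2 ->
  (cval g a0 a1 * cval g a1 a2)%g = cval g a0 a2.
Proof.
move=> e01 e12; have e02 := etrans e01 e12.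
pose s2 := Simplex1 (ptmorph e02) (ptmorph e12).
pose u := @Simplex2 R X _ _ _ s2 (ptsimplex e02) (ptsimplex e12) (ptplot (\val P2 a2))
  (morph_id _) (morph_id _) (morph_id _) (fun=> erefl) (fun=> erefl) (fun=> erefl).
by have := cfunM g u pt; rewrite !cocycle_cval.
Qed.

(** L0 and L1 are the legs of a 1-simplex with source the plot P1 o L1. *)
Lemma cval_smooth C (g : cocycle G C) (P0 P1 : C) m (V : domain R m)
    (L0 : V -> pdom (\val P0)) (L1 : V -> pdom (\val P1)) :
  dsmooth L0 -> dsmooth L1 -> (forall r, \val P0 (L0 r) = \val P1 (L1 r)) ->
  smooth (domSp V) G (fun r => cval g (L0 r) (L1 r)).
Proof.
move=> s0 s1 e.
pose Q := Plot (dplot_comp (plotP (\val P1)) s1 : isplot (X := X) _).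
pose s := @Simplex1 R X _ _ Q (@Morph R X Q _ L0 s0 e) (@Morph R X Q _ L1 s1 (fun=> erefl)).
have := cfun_smooth g s; congr (smooth _ _ _); apply/funext => r.
exact: cocycle_cval.
Qed.

Lemma cval_rcocycle C' C (l : refinement C' C) (g : cocycle G C) (b0 b1 : C')
    (a0 : pdom (\val b0)) (a1 : pdom (\val b1)) :
  \val b0 a0 = \val b1 a1 ->
  cval (rcocycle l g) a0 a1 = cval g (rmor l b0 a0) (rmor l b1 a1).
Proof.
move=> e; transitivity (rcocycle l g b0 b1 (ptsimplex e) pt).
  by rewrite cocycle_cval.
exact: (@cocycle_cval _ g _ _ (rsimplex l (ptsimplex e)) pt).
Qed.

Lemma cohomologous_cval C (g g' : cocycle G C) :
  (exists h : forall P : C, pdom (\val P) -> G,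
    (forall P : C, smooth (domSp (pdom (\val P))) G (h P)) /\
    forall (P0 P1 : C) (a0 : pdom (\val P0)) (a1 : pdom (\val P1)),
      \val P0 a0 = \val P1 a1 ->
      (cval g' a0 a1 * h P1 a1 = h P0 a0 * cval g a0 a1)%g) ->
  cohomologous g g'.
Proof.
move=> [h [hs hE]]; exists h; split=> // P0 P1 s r; rewrite !cocycle_cval.
by apply: hE; exact: simplex1E.
Qed.

(** Both l and l' send a point of a plot of C' to points over the same
point of X, and the value of g between these two points is the cochain sought:
both sides of the relation are then values of g from l' b0 to l b1. *)
Lemma rcocycle_indep C' C (l l' : refinement C' C) (g : cocycle G C) :
  cohomologous (rcocycle l g) (rcocycle l' g).
Proof.
apply: cohomologous_cval.
have e b r : \val (l' b) (rmor l' b r) = \val (l b) (rmor l b r) by rewrite !mfunE.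
exists (fun b r => cval g (rmor l' b r) (rmor l b r)); split=> [b|b0 b1 a0 a1 a01].
  by apply: cval_smooth => //; exact: mfun_smooth.
by rewrite !cval_rcocycle// !cvalM// !mfunE.
Qed.

Lemma cocycle_ext C (g g' : cocycle G C) :
  (forall P0 P1 s r, g P0 P1 s r = g' P0 P1 s r) -> cohomologous g g'.
Proof.
move=> E; exists (fun _ _ => 1%g); split=> [P|P0 P1 s r]; first exact: smooth_cst.
by rewrite mulg1 mul1g E.
Qed.

Definition rid C : refinement C C := Refinement (fun b : C => morph_id (\val b)).

Definition rcomp C C' C'' (l : refinement C' C) (l' : refinement C'' C') :
  refinement C'' C := Refinement (fun b => mcomp (rmor l (l' b)) (rmor l' b)).

Lemma rcocycle_comp C C' C'' (l : refinement C' C) (l' : refinement C'' C')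
    (g : cocycle G C) :
  cohomologous (rcocycle (rcomp l l') g) (rcocycle l' (rcocycle l g)).
Proof.
by apply: cocycle_ext => b0 b1 s r /=; rewrite !cocycle_cval.
Qed.

(** The relation which the direct limit puts on cocycles, before passing to the
sets H^1(X, C, G); see [cech_eqE]. *)
Definition cech_rel C C' (g : cocycle G C) (g' : cocycle G C') : Prop :=
  exists (D : covgen X) (l : refinement D C) (l' : refinement D C'),
    cohomologous (rcocycle l g) (rcocycle l' g').

Lemma cech_rel_cohomologous C (g g' : cocycle G C) :
  cohomologous g g' -> cech_rel g g'.
Proof.
by move=> gg'; exists C, (rid C), (rid C); exact: rcocycle_cohomologous.
Qed.

Lemma cech_rel_refl C (g : cocycle G C) : cech_rel g g.
Proof. exact/cech_rel_cohomologous/cohomologous_refl. Qed.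

Lemma cech_rel_sym C C' (g : cocycle G C) (g' : cocycle G C') :
  cech_rel g g' -> cech_rel g' g.
Proof.
by move=> [D [l [l' gg']]]; exists D, l', l; exact: cohomologous_sym.
Qed.

(** On a common refinement of the two given ones, the cocycle in the middle is
restricted in two ways, which are cohomologous by [rcocycle_indep]. *)
Lemma cech_rel_trans C C' C'' (g : cocycle G C) (g' : cocycle G C')
    (g'' : cocycle G C'') : cech_rel g g' -> cech_rel g' g'' -> cech_rel g g''.
Proof.
move=> [D [l [l' gg']]] [D' [m [m' g'g'']]].
have [E [k [k' _]]] := common_refinement D D'.
exists E, (rcomp l k), (rcomp m' k').
apply: cohomologous_trans (rcocycle_comp _ _ _) _.
apply: cohomologous_trans (rcocycle_cohomologous k gg') _.
apply: cohomologous_trans (cohomologous_sym (rcocycle_comp _ _ _)) _.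
apply: cohomologous_trans (rcocycle_indep _ (rcomp m k') _) _.
apply: cohomologous_trans (rcocycle_comp _ _ _) _.
apply: cohomologous_trans (rcocycle_cohomologous k' g'g'') _.
exact/cohomologous_sym/rcocycle_comp.
Qed.

Lemma cech_eqE C C' (g : cocycle G C) (g' : cocycle G C') :
  cech_eq (Tagged (CechH1on G) (cls _ g)) (Tagged (CechH1on G) (cls _ g')) <->
  cech_rel g g'.
Proof.
rewrite /cech_eq /=; split=> -[D [l [l' gg']]]; exists D, l, l'.
  by move: gg'; rewrite !jmapE => /cls_cohomologous.
by rewrite !jmapE; exact/cls_cohomologous.
Qed.

Lemma cech_class_eq C C' (g : cocycle G C) (g' : cocycle G C') :
  cech_class g = cech_class g' <-> cech_rel g g'.
Proof.
split=> [[/(congr1 (@^~ (Tagged (CechH1on G) (cls _ g'))))]|gg'].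
  by move=> E; apply/cech_eqE; rewrite E; apply/cech_eqE; exact: cech_rel_refl.
apply: quotient_eq; apply/funext => -[D d] /=; rewrite -(qreprK d).
apply/propext; split=> /cech_eqE gd; apply/cech_eqE; apply: cech_rel_trans gd => //.
exact: cech_rel_sym.
Qed.

End CocycleValues.

(** * Smooth actions *)

Section Action.
Context {R : realType} {T : diffSpace R} {G : diffGroup R} (rho : G -> DiffT T).
Context (rho_morph : {morph rho : g h / (g * h)%g}).

Lemma actM g h t : dfwd (rho (g * h)%g) t = dfwd (rho g) (dfwd (rho h) t).
Proof. by rewrite rho_morph. Qed.

Lemma act1 t : dfwd (rho 1%g) t = t.
Proof.
have -> : rho 1%g = 1%g by apply: (mulgI (rho 1%g)); rewrite -rho_morph !mulg1.
by [].
Qed.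

Lemma act_inj (g h : G) : injective rho -> dfwd (rho g) =1 dfwd (rho h) -> g = h.
Proof. by move=> inj_rho gh; apply: inj_rho; exact: diffeo_eq. Qed.

Lemma act_smooth (Z : diffSpace R) (f : Z -> G) (tau : Z -> T) :
  smooth G (DiffT T) rho -> smooth Z G f -> smooth Z T tau ->
  smooth Z T (fun z => dfwd (rho (f z)) (tau z)).
Proof.
move=> rs fs ts n A pA; have [sA _] := rs _ _ (fs _ _ pA).
apply: (sA n (Param (fun r : pdom A => (r, tau (A r))))).
by split; [exact: dsmooth_id|exact: ts].
Qed.

End Action.

(** * The cocycle of a bundle and isomorphisms of bundles *)

Section BundleTheory.
Arguments btransE {R X T G rho} b {P0 P1} s r t : rename.
Context {R : realType} {X T : diffSpace R} {G : diffGroup R} {rho : G -> DiffT T}.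
Implicit Type B : bundle X rho.

Lemma btrivE B (P : bfam B) r t : bproj B (btriv B P (r, t)) = \val P r.
Proof. exact: (btriv_pullback P).1. Qed.

(** The uniqueness in the pullback property, tested on a one-point space. *)
Lemma btriv_inj B (P : bfam B) r t t' :
  btriv B P (r, t) = btriv B P (r, t') -> t = t'.
Proof.
move=> tt'; have [_ /(_ (domSp pt_dom) (fun=> r) (fun=> btriv B P (r, t)))] :=
  btriv_pullback P.
case=> [||z|u [_ uU]]; [exact: smooth_cst|exact: smooth_cst|exact: btrivE|].
have E t0 : btriv B P (r, t0) = btriv B P (r, t) -> u = fun=> (r, t0).
  by move=> Et0; apply: uU; split=> //; exact: smooth_cst.
have := etrans (esym (E t erefl)) (E t' (esym tt')).
by move=> /(congr1 (@^~ pt)) /= [].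
Qed.

(** The existence in the pullback property: a smooth family of points of E over a
smooth family of points of dom P has a smooth fiber coordinate. *)
Lemma btriv_lift B (P : bfam B) (Z : diffSpace R) (b : Z -> pdom (\val P))
    (e : Z -> btot B) : smooth Z (domSp (pdom (\val P))) b -> smooth Z (btot B) e ->
    (forall z, bproj B (e z) = \val P (b z)) ->
  exists tau : Z -> T, smooth Z T tau /\ forall z, btriv B P (b z, tau z) = e z.
Proof.
move=> bs es be; have [_ /(_ Z b e bs es be)[u [[us ub ue] _]]] := btriv_pullback P.
exists (fun z => (u z).2); split; first exact: (smooth_comp (@smooth_snd _ _ _) us).
by move=> z; rewrite -ub -surjective_pairing ue.
Qed.

Lemma btriv_surj B (P : bfam B) r e : bproj B e = \val P r ->
  exists t, btriv B P (r, t) = e.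
Proof.
move=> er; have [||z|tau [_ /(_ pt) tauE]] := @btriv_lift B P (domSp pt_dom)
  (fun=> r) (fun=> e) => //; [exact: smooth_cst|exact: smooth_cst|].
by exists (tau pt).
Qed.

Section TransitionCocycle.
Context (rho_morph : {morph rho : g h / (g * h)%g}).
Context (rho_inj : injective rho).

(** Both sides move the same point between the trivializations of P0 and P2;
injectivity on fibers and faithfulness of rho remove the points. *)
Lemma btransM B (P0 P1 P2 : bfam B) (s : simplex2 (\val P0) (\val P1) (\val P2))
    (r : pdom (s2Q s)) :
  (btrans B _ _ (s2S2 s) (s2F2 s r) * btrans B _ _ (s2S0 s) (s2F0 s r))%g =
  btrans B _ _ (s2S1 s) (s2F1 s r).
Proof.
apply: (act_inj rho_inj) => t; apply: (@btriv_inj _ P0 (s1F1 (s2S2 s) (s2F2 s r))).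
rewrite (actM rho_morph) -btransE -s2E02 -btransE s2E01 btransE.
by rewrite s2E12.
Qed.

Definition bcocycle B : cocycle G (bfam B) :=
  @Cocycle R X G (bfam B) (btrans B) (@btrans_smooth _ _ _ _ _ B) (@btransM B).

End TransitionCocycle.

Context (rho_morph : {morph rho : g h / (g * h)%g}).
Context (rho_smooth : smooth G (DiffT T) rho).

(** A cochain h relating the transitions defines a map of bundles, by the formula
that h prescribes in the trivializations. The relation for the 1-simplex on a
single point says that the image of a point of B does not depend on the
trivialization in which it is computed. For smoothness, a plot of E projects to a
plot of X, which factors through D locally, and there [btriv_lift] gives smooth
fiber coordinates. *)
Lemma bundle_map B B' (g : cocycle G (bfam B)) (g' : cocycle G (bfam B'))
    (D : covgen X) (l : refinement D (bfam B)) (l' : refinement D (bfam B'))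
    (h : forall b : D, pdom (\val b) -> G) :
  (forall P0 P1 s r, g P0 P1 s r = btrans B P0 P1 s r) ->
  (forall P0 P1 s r, g' P0 P1 s r = btrans B' P0 P1 s r) ->
  (forall b : D, smooth (domSp (pdom (\val b))) G (h b)) ->
  (forall (b0 b1 : D) (s : simplex1 (\val b0) (\val b1)) (r : pdom (s1Q s)),
    rcocycle l' g' _ _ s r * h b1 (s1F0 s r) = h b0 (s1F1 s r) * rcocycle l g _ _ s r)%g ->
  exists Phi : btot B -> btot B', smooth (btot B) (btot B') Phi /\
    forall (b : D) r t, Phi (btriv B (l b) (rmor l b r, t)) =
                btriv B' (l' b) (rmor l' b r, dfwd (rho (h b r)) t).
Proof.
move=> gE g'E hs hE.
have H e : exists e', forall (b : D) (r : pdom (\val b)) t,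
    btriv B (l b) (rmor l b r, t) = e ->
    e' = btriv B' (l' b) (rmor l' b r, dfwd (rho (h b r)) t).
  have [P [a [DP Pa]]] := cfam_cover D (bproj B e).
  pose b0 : D := SigSub (mem_set DP).
  have [|t0 t0E] := @btriv_surj B (l b0) (rmor l b0 a) e; first by rewrite mfunE.
  exists (btriv B' (l' b0) (rmor l' b0 a, dfwd (rho (h b0 a)) t0)) => b r t tE.
  have e0 : \val b0 a = \val b r by rewrite /= Pa -tE btrivE mfunE.
  have := hE _ _ (ptsimplex e0) pt; rewrite /= g'E gE => hE0.
  have := btransE B' (rsimplex l' (ptsimplex e0)) pt; rewrite /= => ->.
  rewrite -(actM rho_morph) hE0 (actM rho_morph); congr (btriv _ _ (_, dfwd _ _)).
  apply: (@btriv_inj B (l b0) (rmor l b0 a)).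
  by rewrite -(btransE B (rsimplex l (ptsimplex e0)) pt) t0E -tE.
have [Phi PhiE] := choice H; exists Phi.
have {H}PhiE (b : D) r t : Phi (btriv B (l b) (rmor l b r, t)) =
    btriv B' (l' b) (rmor l' b r, dfwd (rho (h b r)) t) by exact: PhiE.
split=> // n A pA; apply: isplot_local => x.
have [V [VA [Vx [b [F [sF FE]]]]]] :=
  @locally_factors _ _ D _ (Defs.pcomp (bproj B) A) x (@bproj_smooth _ _ _ _ _ B _ A pA).
exists V, VA => //.
have sA : smooth (domSp V) (btot B) (fun r => A (dincl VA r)).
  apply: (smooth_plot (X := btot B) (prestrict (P := A) VA)).1; exact: (@prestrict_isplot R (btot B) n A V VA pA).
have sF' := smooth_dom sF.
have [||z|tau [ts tauE]] := @btriv_lift B (l b) (domSp V) (fun r => rmor l b (F r))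
    (fun r => A (dincl VA r)).
- exact: smooth_comp (smooth_dom (mfun_smooth _)) sF'.
- exact: sA.
- by rewrite mfunE FE.
apply/smooth_plot.
have -> : (prestrict (P := Defs.pcomp Phi A) VA : V -> _) = fun r : V =>
    btriv B' (l' b) (rmor l' b (F r), dfwd (rho (h b (F r))) (tau r)).
  by apply/funext => r /=; rewrite -PhiE tauE.
have sZ : smooth (domSp V) (prodSp (domSp (pdom (\val (l' b)))) T)
    (fun r => (rmor l' b (F r), dfwd (rho (h b (F r))) (tau r))).
  apply: smooth_pair.
    exact: smooth_comp (smooth_dom (mfun_smooth _)) sF'.
  by apply: act_smooth => //; exact: smooth_comp (hs b) sF'.
exact: (smooth_comp (@btriv_smooth _ _ _ _ _ B' (l' b)) sZ).
Qed.

(** The inverse of the map attached to h is the map attached to h^-1, because the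
trivializations indexed by D reach every point of either bundle. *)
Lemma iso_of_cech B B' (g : cocycle G (bfam B)) (g' : cocycle G (bfam B')) :
  (forall P0 P1 s r, g P0 P1 s r = btrans B P0 P1 s r) ->
  (forall P0 P1 s r, g' P0 P1 s r = btrans B' P0 P1 s r) ->
  cech_rel g g' -> bundle_iso B B'.
Proof.
move=> gE g'E [D [l [l' [h [hs hE]]]]].
have [Phi [Ps PhiE]] := bundle_map gE g'E hs hE.
pose k (b : D) r := ((h b r)^-1)%g.
have ks (b : D) : smooth (domSp (pdom (\val b))) G (k b) by exact: smooth_invg.
have kE (b0 b1 : D) (s : simplex1 (\val b0) (\val b1)) (r : pdom (s1Q s)) :
    (rcocycle l g _ _ s r * k b1 (s1F0 s r) = k b0 (s1F1 s r) * rcocycle l' g' _ _ s r)%g.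
  by apply: (mulgI (h b0 (s1F1 s r))); rewrite /k !mulgA -hE mulgK mulgV mul1g.
have [Psi [Qs PsiE]] := bundle_map g'E gE ks kE.
have triv (B0 : bundle X rho) (m : refinement D (bfam B0)) e :
    exists (b : D) r t, e = btriv B0 (m b) (rmor m b r, t).
  have [P [a [DP Pa]]] := cfam_cover D (bproj B0 e).
  pose b : D := SigSub (mem_set DP).
  have [|t tE] := @btriv_surj B0 (m b) (rmor m b a) e; first by rewrite mfunE.
  by exists b, a, t.
have PhiK : cancel Phi Psi.
  move=> e; have [b [r [t ->]]] := triv _ l e.
  by rewrite PhiE PsiE -(actM rho_morph) mulVg (act1 rho_morph).
have PsiK : cancel Psi Phi.
  move=> e; have [b [r [t ->]]] := triv _ l' e.
  by rewrite PsiE PhiE -(actM rho_morph) mulgV (act1 rho_morph).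
exists (Diffeo Ps Qs PhiK PsiK); split=> [e|] /=.
  by have [b [r [t ->]]] := triv _ l e; rewrite PhiE !btrivE !mfunE.
exists D, l, l' => b; exists (h b); split; [exact: hs|exact: PhiE].
Qed.

(** Phi applied to a point of B written in the two trivializations of a 1-simplex
gives the relation between h and the transitions after acting on t. *)
Lemma cech_of_iso B B' (g : cocycle G (bfam B)) (g' : cocycle G (bfam B')) :
  injective rho ->
  (forall P0 P1 s r, g P0 P1 s r = btrans B P0 P1 s r) ->
  (forall P0 P1 s r, g' P0 P1 s r = btrans B' P0 P1 s r) ->
  bundle_iso B B' -> cech_rel g g'.
Proof.
move=> inj gE g'E [Phi [_ [D [l [l' H]]]]]; exists D, l, l'.
pose h b := projT1 (cid (H b)).
have [hs hE] : (forall b : D, smooth (domSp (pdom (\val b))) G (h b)) /\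
    forall (b : D) r t, Phi (btriv B (l b) (rmor l b r, t)) =
      btriv B' (l' b) (rmor l' b r, dfwd (rho (h b r)) t).
  by split=> b; have [] := projT2 (cid (H b)).
exists h; split=> // b0 b1 s r; apply: (act_inj inj) => t.
apply: (@btriv_inj B' (l' b0) (rmor l' b0 (s1F1 s r))).
rewrite !(actM rho_morph) -hE /= gE g'E.
have := btransE B (rsimplex l s) r; rewrite /= => <-.
by have := btransE B' (rsimplex l' s) r; rewrite /= => <-; rewrite hE.
Qed.

End BundleTheory.

(** * The bundle associated with a cocycle *)

Section AssociatedBundle.
Context {R : realType} {X T : diffSpace R} {G : diffGroup R} (rho : G -> DiffT T).
Context (rho_morph : {morph rho : g h / (g * h)%g}).
Context (rho_smooth : smooth G (DiffT T) rho).
Context (C : covgen X) (g : cocycle G C).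

Lemma base_point (x : X) : exists u : {P : C & pdom (\val P)}, \val (tag u) (tagged u) = x.
Proof.
have [P [r [CP Pr]]] := cfam_cover C x.
by exists (Tagged (fun P : C => pdom (\val P)) (i := SigSub (mem_set CP)) r).
Qed.

Definition base x := projT1 (cid (base_point x)).

Lemma baseE x : \val (tag (base x)) (tagged (base x)) = x.
Proof. exact: projT2 (cid (base_point x)). Qed.

(** In the pair e the second component is the coordinate in the trivialization at
the base point over e.1; g moves it to the trivialization at a, which is meant to
lie over e.1. *)
Definition to_chart (P : C) (a : pdom (\val P)) (e : X * T) : T :=
  dfwd (rho (cval g a (tagged (base e.1)))) e.2.

Definition of_chart (P : C) (at_ : pdom (\val P) * T) : X * T :=
  let x := \val P at_.1 in
  (x, dfwd (rho (cval g (tagged (base x)) at_.1)) at_.2).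

(** The base point over P a cancels by multiplicativity, so that the change of
coordinates is smooth although base points are chosen arbitrarily. *)
Lemma to_chart_of_chart (P P' : C) (a : pdom (\val P)) (a' : pdom (\val P')) t :
  \val P' a' = \val P a ->
  to_chart a' (of_chart (a, t)) = dfwd (rho (cval g a' a)) t.
Proof.
by move=> e; rewrite /to_chart /of_chart /= -(actM rho_morph) cvalM// ?baseE.
Qed.

Lemma cval_diag (P : C) (a : pdom (\val P)) : cval g a a = 1%g.
Proof. by apply: (mulgI (cval g a a)); rewrite mulg1 cvalM. Qed.

Lemma of_chart_to_chart (P : C) (a : pdom (\val P)) e :
  \val P a = e.1 -> of_chart (a, to_chart a e) = e.
Proof.
case: e => x t /= ax; rewrite /of_chart /to_chart /= -(actM rho_morph) ax.
by rewrite cvalM ?cval_diag ?(act1 rho_morph) ?baseE.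
Qed.

(** The map K allows the lifts L to exist only after a change of parameters, and
makes the set of plots stable by composition by its very form. *)
Definition tot_plot n : set (param R n (X * T)) :=
  [set A | isplot (X := X) (Defs.pcomp fst A) /\
    forall m (V : domain R m) (K : V -> pdom A) (P : C) (L : V -> pdom (\val P)),
      dsmooth K -> dsmooth L -> (forall r, \val P (L r) = (A (K r)).1) ->
      isplot (X := T) (Param (fun r : V => to_chart (L r) (A (K r))))].

(** Constants have smooth coordinates because cval is smooth along any lift L and
the constant lift at the base point. *)
Lemma tot_cover e : exists n (A : param R n (X * T)) r, tot_plot A /\ A r = e.
Proof.
exists 0%N, (Param (fun _ : pt_dom => e)), pt; split=> //; split; first exact: pt_isplot.
move=> m V K P L sK sL LE; apply/smooth_plot; rewrite /to_chart /=.
apply: act_smooth => //; last exact: smooth_cst.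
apply: cval_smooth => //; first exact: dsmooth_cst.
by move=> r; rewrite baseE LE.
Qed.

Lemma tot_comp n m (A : param R n (X * T)) (V : domain R m) (F : V -> pdom A) :
  tot_plot A -> dsmooth F -> tot_plot (Param (A \o F)).
Proof.
move=> [A1 A2] sF; split; first exact: (dplot_comp A1 sF).
move=> p W K P L sK sL LE; apply: (A2 _ _ (F \o K)) => //.
exact: dsmooth_comp sF sK.
Qed.

Lemma tot_sup n (S : set (param R n (X * T))) A :
  S `<=` @tot_plot n -> compatible S -> is_supremum S A -> tot_plot A.
Proof.
move=> SV _ sA; split; first by apply: (isplot_sup_local sA) => Q /SV[].
move=> m V K P L sK sL LE; apply: isplot_local => x.
have [Q SQ Qx] := supremum_cover (K x) sA.
have [W [WV [K' [Wx sK' KE]]]] := dsmooth_corestrict sK Qx.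
exists W, WV => //.
have QA w : Q (K' w) = A (K (dincl WV w)) by exact: (sA.2 _ SQ).
have := (SV _ SQ).2 m W K' P (L \o dincl WV) sK'.
have sLW : dsmooth (L \o dincl WV) by apply: (dsmooth_comp sL); exact: dsmooth_incl.
move=> /(_ sLW); have LQ w : \val P (L (dincl WV w)) = (Q (K' w)).1 by rewrite QA LE.
move=> /(_ LQ); congr (isplot (X := T) _); congr Param.
by apply/funext => w /=; rewrite QA.
Qed.

Definition totSp : diffSpace R := DiffSpace (Diffeology tot_cover tot_comp tot_sup).

Lemma totSp_fst : smooth totSp X fst.
Proof. by move=> n A []. Qed.

Lemma of_chart_smooth (P : C) :
  smooth (prodSp (domSp (pdom (\val P))) T) totSp (@of_chart P).
Proof.
move=> n A [A1 A2]; split.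
  exact: (dplot_comp (plotP (\val P)) A1).
move=> m V K P' L sK sL LE; apply/smooth_plot.
have sAK : dsmooth (fun r => (A (K r)).1) by exact: dsmooth_comp A1 sK.
have tAK : smooth (domSp V) T (fun r => (A (K r)).2).
  by apply: (smooth_plot (Param (fun r => (A (K r)).2))).1; exact: (dplot_comp A2 sK).
have := act_smooth rho_smooth (cval_smooth g sL sAK LE) tAK.
congr (smooth _ _ _); apply/funext => r /=.
rewrite [A (K r) in RHS]surjective_pairing to_chart_of_chart//; exact: LE.
Qed.

Lemma of_chart_pullback (P : C) :
  is_pullback (A := prodSp (domSp (pdom (\val P))) T) (B := domSp (pdom (\val P)))
    (E := totSp) (X := X) fst (@of_chart P) (\val P) fst.
Proof.
split=> [//|Z b e bs es be].
exists (fun z => (b z, to_chart (b z) (e z))); split; last first.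
  move=> u [us ub ue]; apply/funext => z; rewrite -ue -ub.
  case: (u z) => a t; rewrite to_chart_of_chart// cval_diag (act1 rho_morph)//.
split=> // [|z]; last by rewrite of_chart_to_chart.
apply: smooth_pair => // n A pA.
have [_ eA] := es _ _ pA.
apply: (eA _ _ id P (fun r => b (A r))) => //; first exact: dsmooth_id.
  exact: bs.
by move=> r; rewrite be.
Qed.

Lemma of_chartE (P0 P1 : C) (s : simplex1 (\val P0) (\val P1)) r t :
  of_chart (s1F0 s r, t) = of_chart (s1F1 s r, dfwd (rho (g _ _ s r)) t).
Proof.
rewrite /of_chart /= -(actM rho_morph) cocycle_cval simplex1E; congr (_, _).
by rewrite cvalM ?simplex1E ?baseE.
Qed.

Definition assoc_bundle : bundle X rho :=
  Bundle totSp_fst of_chart_smooth of_chart_pullback (@cfun_smooth _ _ _ _ g) of_chartE.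

End AssociatedBundle.

(** * The correspondence *)

Theorem mainTheorem2 (R : realType) (X T : diffSpace R) (G : diffGroup R)
    (rho : G -> DiffT T)
    (rho_morph : {morph rho : g h / (g * h)%g})
    (rho_smooth : smooth G (DiffT T) rho)
    (rho_faithful : injective rho) :
  exists Theta : CechH1 X G -> Bund X rho,
    bijective Theta /\
    forall (B : bundle X rho) (g : cocycle G (bfam B)),
      (forall P0 P1 s r, g P0 P1 s r = btrans B P0 P1 s r) ->
      Theta (cech_class g) = cls (@bundle_iso R X T G rho) B.
Proof.
pose bcoc (B : bundle X rho) := bcocycle rho_morph rho_faithful B.
pose bun (C : covgen X) (g : cocycle G C) := assoc_bundle rho_morph rho_smooth g.
have isoP (B B' : bundle X rho) : bundle_iso B B' <-> cech_rel (bcoc B) (bcoc B').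
  by split; [exact: cech_of_iso|exact: iso_of_cech].
have clsP (B B' : bundle X rho) : cls (@bundle_iso R X T G rho) B = cls _ B' <-> bundle_iso B B'.
  split=> [[->]|BB']; first exact/isoP/cech_rel_refl.
  apply: quotient_eq; apply/funext => B''; apply/propext.
  split=> /isoP E; apply/isoP; apply: cech_rel_trans E; last exact/isoP.
  by apply: cech_rel_sym; exact/isoP.
pose Psi (A : Bund X rho) : CechH1 X G := cech_class (bcoc (qrepr A)).
have PsiE B : Psi (cls _ B) = cech_class (bcoc B).
  by apply/cech_class_eq/isoP/clsP; exact: qreprK.
pose Theta (a : CechH1 X G) : Bund X rho :=
  cls _ (bun _ (qrepr (tagged (qrepr a)))).
have PsiTheta : cancel Theta Psi.
  move=> a; rewrite PsiE -[RHS]qreprK; case: (qrepr a) => C c /=.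
  rewrite -{2}(qreprK c); apply/cech_class_eq/cech_rel_cohomologous.
  exact: cocycle_ext.
have ThetaE B (g : cocycle G (bfam B)) :
    (forall P0 P1 s r, g P0 P1 s r = btrans B P0 P1 s r) ->
    Theta (cech_class g) = cls _ B.
  move=> gE; apply/clsP/isoP/cech_class_eq; rewrite -PsiE PsiTheta.
  exact/cech_class_eq/cech_rel_cohomologous/cocycle_ext.
exists Theta; split=> //; exists Psi => // A.
by rewrite -(qreprK A) PsiE ThetaE.
Qed.
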